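(* Let $n\geq 3$ and let $S\in\{\mathcal{I}_n,\mathcal{T}_n,\mathcal{PT}_n\}$. Put $\epsilon=0$ if $S\in\{\mathcal{PT}_n,\mathcal{I}_n\}$ and $\epsilon=1$ if $S=\mathcal{T}_n$. For $m\in\{\epsilon,\dots,n\}$ let $I_m$ be the ideal of all mappings in $S$ of rank at most $m$. Then the relational depth of $I_m$ is $$\mathrm{depth}(I_m)=\begin{cases} m-\max(\epsilon,2m-n)+1 & \text{if } m<n,\\ 3 & \text{if } m=n.\end{cases}$$
   Context: Write $[n]=\{1,\dots,n\}$. $\mathcal{PT}_n$ is the monoid of all partial mappings $[n]\to[n]$ (including the empty map), $\mathcal{I}_n$ the submonoid of all partial bijections (injective partial maps), $\mathcal{T}_n$ the submonoid of all full mappings; the operation is composition, with maps written on the right ($\alpha\beta$ means first $\alpha$, then $\beta$). The rank of a map is the size of its image. The $\mathcal{J}$-classes of $I_m$ are $J_r=\{\alpha\in S:\mathrm{rank}(\alpha)=r\}$, $\epsilon\le r\le m$, and they form a chain $J_\epsilon<J_{\epsilon+1}<\dots<J_m$. A semigroup presentation is a pair $\langle A\mid R\rangle$ with $A$ a finite alphabet and $R\subseteq A^+\times A^+$ a set of defining relations, a pair $(u,v)$ being written $u=v$; it is a presentation for a semigroup $T$ (it defines $T$) if $T\cong A^+/R^\sharp$, where $R^\sharp$ is the smallest congruence on $A^+$ containing $R$. Via this isomorphism each word in $A^+$ represents an element of $T$. Relational depth: let $T$ be a finite semigroup whose $\mathcal{J}$-classes form a chain $J_\epsilon<\dots<J_k$.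 The depth of $J_i$ is $k-i+1$; the depth of an element is the depth of its $\mathcal{J}$-class; given a presentation $\langle A\mid R\rangle$ for $T$, the depth of a word is the depth of the element it represents, the depth of a relation $u=v$ in $R$ is the common depth of $u$ and $v$, and the depth of the presentation is the maximal depth of a relation in $R$. The relational depth $\mathrm{depth}(T)$ is the minimum of the depths of all presentations for $T$. (For $T=I_m$ the depth of $J_i$ is $m-i+1$.) *)

(* Defs.v *)
From HB Require Import structures.
From mathcomp Require Import all_boot.
From mathcomp Require Import boolp.

Set Implicit Arguments.
Unset Strict Implicit.
Unset Printing Implicit Defensive.

Local Open Scope group_scope.
Local Open Scope quotient_scope.

(* The free semigroup A^+ on the alphabet A. *)
Definition word (A : choiceType) := {w : seq A | w != [::]}.

HB.instance Definition _ (A : choiceType) := SubType.on (word A).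
HB.instance Definition _ (A : choiceType) := Choice.on (word A).

Section FreeSemigroup.
Variable A : choiceType.

Fact word_mul_subproof (u v : word A) : val u ++ val v != [::].
Proof. by case: u v => [[]] // a s _ [[]]. Qed.

Definition word_mul (u v : word A) : word A :=
  Sub (val u ++ val v) (word_mul_subproof u v).

Fact word_mulA : associative word_mul.
Proof. by move=> u v w; apply: val_inj; rewrite /= catA. Qed.

HB.instance Definition _ := isSemigroup.Build (word A) word_mulA.

End FreeSemigroup.

Section Congruence.
Variables (G : semigroupType) (R : G -> G -> Prop).

(* R^sharp, the smallest congruence on G containing R. *)
Inductive congruence : G -> G -> Prop :=
| cong_rel u v : R u v -> congruence u v
| cong_refl u : congruence u u
| cong_sym u v : congruence u v -> congruence v u
| cong_trans u v w : congruence u v -> congruence v w -> congruence u w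
| cong_mul u u' v v' :
    congruence u u' -> congruence v v' -> congruence (u * v) (u' * v').

Definition congruenceb : rel G := fun u v => `[< congruence u v >].

Fact congruenceb_refl : reflexive congruenceb.
Proof. by move=> u; apply/asboolP; apply: cong_refl. Qed.

Fact congruenceb_sym : symmetric congruenceb.
Proof. by move=> u v; apply/asboolP/asboolP; apply: cong_sym. Qed.

Fact congruenceb_trans : transitive congruenceb.
Proof.
move=> v u w /asboolP uv /asboolP vw; apply/asboolP.
exact: cong_trans uv vw.
Qed.

Canonical congruence_equiv :=
  EquivRel congruenceb congruenceb_refl congruenceb_sym congruenceb_trans.

Definition cong_quot := {eq_quot congruence_equiv}.

HB.instance Definition _ := Choice.on cong_quot.
HB.instance Definition _ := EqQuotient.on cong_quot.

Definition cong_class (u : G) : cong_quot := \pi_cong_quot u.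

Lemma cong_classP u v : cong_class u = cong_class v <-> congruence u v.
Proof. by split=> [/eqmodP/asboolP|uv] //; apply/eqmodP/asboolP. Qed.

Definition cong_quot_mul (x y : cong_quot) : cong_quot :=
  cong_class (repr x * repr y).

Lemma cong_classK x : cong_class (repr x) = x.
Proof. exact: reprK. Qed.

Lemma cong_class_mul u v :
  cong_quot_mul (cong_class u) (cong_class v) = cong_class (u * v).
Proof.
by apply/cong_classP; apply: cong_mul; apply/cong_classP; exact: cong_classK.
Qed.

Fact cong_quot_mulA : associative cong_quot_mul.
Proof.
move=> x y z; rewrite -(cong_classK x) -(cong_classK y) -(cong_classK z).
by rewrite !cong_class_mul mulgA.
Qed.

HB.instance Definition _ := isSemigroup.Build cong_quot cong_quot_mulA.

End Congruence.

#[short(type="finSemigroupType")]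
HB.structure Definition FinSemigroup := {T of Semigroup T & Finite T}.

(* The set of relations is not required to be finite. *)
Record presentation (T : semigroupType) := Presentation {
  alphabet : finType;
  relations : word alphabet -> word alphabet -> Prop;
  pres_iso : {multiplicative cong_quot relations -> T};
  pres_iso_bij : bijective pres_iso
}.

Definition represents (T : semigroupType) (P : presentation T)
  (w : word (alphabet P)) : T := pres_iso P (cong_class (@relations T P) w).

Section Depth.
Variable T : finSemigroupType.
Implicit Types x y : T.

(* T^1 x T^1 *)
Definition principal_ideal x : {set T} :=
  x |: [set a * x | a : T] :|: [set x * b | b : T]
    :|: [set a * x * b | a : T, b : T].

Definition J_class x : {set T} :=
  [set y | principal_ideal y == principal_ideal x].

(* The number of J-classes greater than or equal to that of x. When the
   J-classes form a chain J_eps < ... < J_k and x belongs to J_i, these are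
   J_i, ..., J_k, so that depth x = k - i + 1. *)
Definition depth x : nat :=
  #|[set J_class y | y : T & principal_ideal x \subset principal_ideal y]|.

(* d is the maximal depth of a relation of P; the two sides of a relation
   represent the same element of T, so the left one determines its depth. *)
Definition presentation_depth_is (P : presentation T) (d : nat) : Prop :=
  (exists u v, @relations T P u v /\ depth (represents u) = d) /\
  (forall u v, @relations T P u v -> depth (represents u) <= d).

Definition relational_depth_is (d : nat) : Prop :=
  (exists P : presentation T, presentation_depth_is P d) /\
  (forall (P : presentation T) e, presentation_depth_is P e -> d <= e).

End Depth.

(* Partial maps of an n-element set; None means undefined. *)
Definition ptrans (n : nat) := {ffun 'I_n -> option 'I_n}.

HB.instance Definition _ n := Finite.on (ptrans n).

Section PartialMaps.
Variable n : nat.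
Implicit Types f g : ptrans n.

(* Maps act on the right: first f, then g. *)
Definition ptrans_mul f g : ptrans n := [ffun x => obind g (f x)].

Fact ptrans_mulA : associative ptrans_mul.
Proof.
by move=> f g h; apply/ffunP=> x; rewrite !ffunE; case: (f x) => //= y; rewrite ffunE.
Qed.

HB.instance Definition _ := isSemigroup.Build (ptrans n) ptrans_mulA.

Definition pimage f : {set 'I_n} := [set y | [exists x, f x == Some y]].

Definition rank f : nat := #|pimage f|.

Definition partial_injective f : bool :=
  [forall x, forall y, (f x == f y) && (f x != None) ==> (x == y)].

Definition total f : bool := [forall x, f x != None].

Lemma rank_mulr f g : rank (f * g) <= rank g.
Proof.
apply: subset_leq_card; apply/subsetP=> z; rewrite !inE => /existsP[x].
rewrite ffunE; case: (f x) => //= y gy; apply/existsP; exists y; exact: gy.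
Qed.

End PartialMaps.

Variant transf_monoid := SymInv | FullTransf | PartTransf.

Definition in_monoid (S : transf_monoid) (n : nat) : pred (ptrans n) :=
  match S with
  | SymInv => @partial_injective n
  | FullTransf => @total n
  | PartTransf => xpredT
  end.

Definition min_rank (S : transf_monoid) : nat :=
  if S is FullTransf then 1%N else 0%N.

Section RankIdeal.
Variables (S : transf_monoid) (n m : nat).

Definition rank_ideal_pred : pred (ptrans n) :=
  [pred f | in_monoid S f && (rank f <= m)].

Fact in_monoid_mul (f g : ptrans n) :
  in_monoid S f -> in_monoid S g -> in_monoid S (f * g).
Proof.
case: S => //= [/'forall_forallP injf /'forall_forallP injg|].
- apply/'forall_forallP=> x y; apply/implyP; rewrite !ffunE.
  have := injf x y; case: (f x) (f y) => [a|] [b|] //=.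
  - move=> fxy /andP[eqg neg]; have := injg a b.
    by rewrite eqg neg => /eqP eab; move: fxy; rewrite eab eqxx.
  - by move=> _ /andP[/eqP-> /eqP].
  - by move=> _ /andP[_ /eqP].
- move=> /forallP totf /forallP totg; apply/forallP=> x; rewrite ffunE.
  by have := totf x; case: (f x) => //= y _; apply: totg.
Qed.

Fact rank_ideal_mul_closed : mulg_closed rank_ideal_pred.
Proof.
move=> f g /andP[Sf _] /andP[Sg leg]; apply/andP; split.
  exact: in_monoid_mul.
exact: leq_trans (rank_mulr f g) leg.
Qed.

Definition rank_ideal := {f : ptrans n | rank_ideal_pred f}.

HB.instance Definition _ := SubType.on rank_ideal.
HB.instance Definition _ := Finite.on rank_ideal.
HB.instance Definition _ :=
  SubChoice_isSubSemigroup.Build (ptrans n) rank_ideal_pred rank_ideal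
    rank_ideal_mul_closed.

End RankIdeal.

(* Main.v *)
Require Import Defs.
From mathcomp Require Import all_boot.
From HB Require Import structures.
From mathcomp Require Import perm boolp zify.

(* Put m' = min(m, n - 1) and r = max(eps, 2m' - n); the claimed depth is
   m - r + 1, so the critical rank is r.

   Lower bound. Choose b, c of rank m' with bc of rank r. If uv represents bc
   with u = b and v = c, a relation of rank > r can only be applied across the
   cut between u and v when one of the two factors it touches is a unit: two
   factors of rank m' have the same image, respectively kernel, as b and c, so
   that their product has rank r. Hence any word reachable from uv has a prefix
   of value bg, g a unit. A word for b'c = bc, where b and b' have incomparable
   kernels, has no such prefix.

   Upper bound. Take all elements of rank >= r as generators, and all relations
   of rank >= r that hold. Going down from rank r, assume that the relations of
   rank > k are consequences, k < r. A word of rank k can be rewritten as bc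
   with b, c of rank > k, and (bd)c = b(dc) if bd and dc have rank > k. These
   moves connect all factorizations of a given element of rank k, because
   k < 2m - n excludes that b and c both have rank m. *)

Set Implicit Arguments.
Unset Strict Implicit.
Unset Printing Implicit Defensive.

(** * Ranks and images *)

Section Rank.
Variable n : nat.
Implicit Types (f g h : ptrans n) (C : {set 'I_n}) (x y : 'I_n).
Local Open Scope group_scope.

Lemma ptrans_mulE f g x : (f * g) x = obind g (f x).
Proof. by rewrite ffunE. Qed.

Lemma pimageP f y : reflect (exists x, f x = Some y) (y \in pimage f).
Proof.
by rewrite inE; apply: (iffP existsP) => -[x] => [/eqP|fx]; exists x; rewrite ?fx.
Qed.

Lemma mem_pimage f x y : f x = Some y -> y \in pimage f.
Proof. by move=> fx; apply/pimageP; exists x. Qed.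

Lemma rank_le_card f C : (forall x y, f x = Some y -> y \in C) -> rank f <= #|C|.
Proof.
by move=> fC; apply/subset_leq_card/subsetP => y /pimageP[x /fC].
Qed.

Lemma pimage_mul f g y :
  reflect (exists2 x, x \in pimage f & g x = Some y) (y \in pimage (f * g)).
Proof.
apply: (iffP (pimageP _ _)) => [[x]|[x /pimageP[z fz] gx]].
  by rewrite ptrans_mulE; case fx: (f x) => [z|] //= gz; exists z => //; apply: mem_pimage fx.
by exists z; rewrite ptrans_mulE fz.
Qed.

Lemma card_Some_imset C : #|Some @: C| = #|C|.
Proof. by apply: card_imset => ? ? []. Qed.

Lemma Some_pimage_mul f g : Some @: pimage (f * g) \subset g @: pimage f.
Proof.
apply/subsetP => _ /imsetP[y /pimage_mul[x fx gx] ->].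
by apply/imsetP; exists x.
Qed.

Lemma rank_mull f g : rank (f * g) <= rank f.
Proof.
rewrite /rank -(card_Some_imset (pimage (f * g))).
apply: leq_trans (leq_imset_card g _).
exact: subset_leq_card (Some_pimage_mul f g).
Qed.

Lemma pimage_mulr f g : pimage (f * g) \subset pimage g.
Proof. by apply/subsetP => y /pimage_mul[x _ /mem_pimage]. Qed.

Lemma rank_leq f : rank f <= n.
Proof. by rewrite -[leqRHS]card_ord; apply: max_card. Qed.

Lemma rank_mul_eqr f g : rank (f * g) = rank g -> pimage (f * g) = pimage g.
Proof. by rewrite /rank => e; apply/eqP; rewrite eqEcard pimage_mulr e /=. Qed.

(** Equal ranks force [f * g] and [g] to have the same image, so [h] finds the same points to act on
    after either of them. *)
Lemma leq_rank_mul f g h : rank (f * g) = rank g -> rank (g * h) <= rank (f * g * h).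
Proof.
move=> /rank_mul_eqr e; apply: subset_leq_card; apply/subsetP => y.
by move=> /pimage_mul[x gx hx]; apply/pimage_mul; exists x; rewrite ?e.
Qed.

(** The image of [f * g] embeds into [g @: pimage f], which has at most [rank f] elements. Equality
    leaves no room for [g] to identify two points of [pimage f] or to be undefined at one. *)
Lemma rank_mul_eql f g : rank (f * g) = rank f ->
  {in pimage f &, injective g} /\ {in pimage f, forall x, g x}.
Proof.
move=> e; have gC : #|g @: pimage f| = #|pimage f|.
  apply/eqP; rewrite eqn_leq leq_imset_card /= -/(rank f) -e /rank.
  rewrite -(card_Some_imset (pimage (f * g))).
  exact: subset_leq_card (Some_pimage_mul f g).
have fE : Some @: pimage (f * g) = g @: pimage f.
  by apply/eqP; rewrite eqEcard Some_pimage_mul gC card_Some_imset; rewrite /rank in e; rewrite e leqnn.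
split; first by apply/imset_injP; rewrite gC.
move=> x fx; have : g x \in g @: pimage f by apply: imset_f.
by rewrite -fE => /imsetP[y _ ->].
Qed.

Lemma rank_mul_mid f g h : rank (g * h) = rank g -> rank (f * g * h) = rank (f * g).
Proof.
move=> /rank_mul_eql[inj def]; apply/eqP; rewrite eqn_leq rank_mull /=.
rewrite /rank -(card_Some_imset (pimage (f * g * h))) -(@card_in_imset _ _ h (pimage (f * g))); last first.
  by move=> x y /(subsetP (pimage_mulr _ _)) ? /(subsetP (pimage_mulr _ _)) ?; apply: inj.
apply/subset_leq_card/subsetP => _ /imsetP[x fgx ->].
have := def x (subsetP (pimage_mulr _ _) x fgx).
by case hx: (h x) => [y|] // _; apply: imset_f; apply/pimage_mul; exists x.
Qed.

Definition ptrans_id : ptrans n := [ffun x => Some x].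

Lemma ptrans_mul1 f : ptrans_id * f = f.
Proof. by apply/ffunP => x; rewrite ptrans_mulE ffunE. Qed.

Lemma ptrans_mulf1 f : f * ptrans_id = f.
Proof. by apply/ffunP => x; rewrite ptrans_mulE; case: (f x) => //= y; rewrite ffunE. Qed.

Lemma rank_inj f : (forall x, f x) -> injective f -> rank f = n.
Proof.
move=> tot inj; apply/eqP; rewrite eqn_leq rank_leq /=.
rewrite /rank -[leqLHS](card_ord n) -(card_imset (mem 'I_n) inj) -card_Some_imset.
apply/subset_leq_card/subsetP => _ /imsetP[x _ ->].
by have := tot x; case fx: (f x) => [y|] // _; apply/imset_f/mem_pimage/fx.
Qed.

Lemma rank_ptrans_id : rank ptrans_id = n.
Proof. by apply: rank_inj => [x|x y]; rewrite !ffunE // => -[]. Qed.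

(** Maps of rank [n] are the units: surjectivity gives [g], and injectivity is [rank_mul_eql]
    applied to [ptrans_id * f]. *)
Lemma rank_full_inv f : rank f = n -> exists2 g, f * g = ptrans_id & g * f = ptrans_id.
Proof.
move=> e; have fT : pimage f = setT by apply/eqP; rewrite eqEcard subsetT cardsT card_ord; rewrite /rank in e; rewrite e /=.
pose g : ptrans n := [ffun y => [pick x | f x == Some y]].
have gf : g * f = ptrans_id.
  apply/ffunP => y; rewrite ptrans_mulE !ffunE; case: pickP => [x /eqP //|no].
  by have /pimageP[x fx] : y \in pimage f; [rewrite fT inE | have := no x; rewrite fx eqxx].
have [] : {in pimage ptrans_id &, injective f} /\ {in pimage ptrans_id, forall x, f x}.
  apply: rank_mul_eql; rewrite ptrans_mul1 e rank_ptrans_id //.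
have idT x : x \in pimage ptrans_id by apply: (@mem_pimage _ x); rewrite ffunE.
move=> inj def; exists g => //; apply/ffunP => x; rewrite ptrans_mulE !ffunE.
have := def x (idT x); case fx: (f x) => [y|] //= _; rewrite ffunE.
case: pickP => [x' /eqP fx'|no]; last by have := no x; rewrite fx eqxx.
by congr Some; apply: inj; rewrite ?idT // fx fx'.
Qed.

(** The value at such a point can be changed without losing an image point. *)
Definition non_isolated f x := f x = None \/ exists2 x', x' != x & f x' = f x.

Lemma non_isolated_ex f : rank f < n -> exists x, non_isolated f x.
Proof.
move=> lt; apply: contrapT => no.
suff e : rank f = n by rewrite e ltnn in lt.
apply: rank_inj => [x|x y fxy].
  by case fx: (f x) => //; case: no; exists x; left.
apply/eqP; apply: contrapT => /negP xy; case: no; exists y; right; exists x => //.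
Qed.

End Rank.

(** * Membership criteria common to the three monoids *)

Section Membership.
Variables (S : transf_monoid) (n : nat).
Implicit Types f g : ptrans n.

Lemma in_monoidI f :
    (S = SymInv -> forall x x' y, f x = Some y -> f x' = Some y -> x = x') ->
    (S = FullTransf -> forall x, f x) ->
  in_monoid S f.
Proof.
case: S => // [/(_ erefl) inj _|_ /(_ erefl) tot] /=.
  apply/'forall_forallP => x x'; apply/implyP => /andP[/eqP e].
  by case fx: (f x) => [y|] // _; apply/eqP; apply: (inj x x' y); rewrite -?e ?fx.
by apply/forallP => x; have := tot x; case: (f x).
Qed.

Lemma in_monoid_inj f : in_monoid S f -> S = SymInv ->
  forall x x' y, f x = Some y -> f x' = Some y -> x = x'.
Proof.
move=> + e; rewrite e /= => /'forall_forallP inj x x' y fx fx'.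
by apply/eqP; have := inj x x'; rewrite fx fx' eqxx.
Qed.

Lemma in_monoid_total f : in_monoid S f -> S = FullTransf -> forall x, f x.
Proof.
by move=> + e; rewrite e /= => /forallP tot x; have := tot x; case: (f x).
Qed.

Lemma min_rank_le f : 0 < n -> in_monoid S f -> min_rank S <= rank f.
Proof.
move=> n0 Sf; case eS: S => //=.
have := in_monoid_total Sf eS (Ordinal n0); case fx: (f _) => [y|] // _.
by apply/card_gt0P; exists y; apply: mem_pimage fx.
Qed.

End Membership.

(** * Factorizations of a partial map through higher ranks *)

Section Factorizations.
Variables (S : transf_monoid) (n m k : nat).
Implicit Types (f g h a b c d : ptrans n) (x y z w : 'I_n).
Local Open Scope group_scope.
Local Notation I := (@rank_ideal_pred S n m).

Lemma rank_mul_lt f g : rank (f * g) < rank g ->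
  exists x y, [/\ g x = Some y, y \notin pimage (f * g) & x \notin pimage f].
Proof.
move=> lt; have /subsetPn[y /pimageP[x gx] fgy] : ~~ (pimage g \subset pimage (f * g)).
  by apply/negP => /subset_leq_card; rewrite leqNgt -/(rank _) lt.
exists x, y; split=> //; apply: contra fgy => fx.
by apply/pimage_mul; exists x.
Qed.

Lemma rank_setU1 f y (C : {set 'I_n}) : pimage f = y |: C -> y \notin C -> rank f = #|C|.+1.
Proof. by rewrite /rank => ->; rewrite cardsU1 => ->. Qed.

Lemma card_setU2_le x y (C : {set 'I_n}) : #|x |: (y |: C)| <= #|C|.+2.
Proof. by rewrite !cardsU1 addnA -add2n leq_add2r; do 2!case: (_ \notin _). Qed.

(* If [f x] is shared or undefined, and [w], [z], [y] lie outside the image of [f],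
   then [split_at f x w * retract_with f x z y] factors [f] through rank one more. *)
Definition split_at f x w : ptrans n := [ffun p => if p == x then Some w else f p].

Definition retract_with f x z y : ptrans n :=
  [ffun p => if p \in pimage f then Some p else if p == z then Some y else f x].

Lemma non_isolated_inj f x : in_monoid S f -> S = SymInv -> non_isolated f x -> f x = None.
Proof.
move=> Sf e [//|[x' nx fx']]; case fx: (f x) => [y|] //.
by rewrite -(in_monoid_inj Sf e fx (etrans fx' fx)) eqxx in nx.
Qed.

Section Canonical.
Variables (f : ptrans n) (x y z w : 'I_n).
Hypotheses (Sf : in_monoid S f) (fx : non_isolated f x).
Hypotheses (wf : w \notin pimage f) (zf : z \notin pimage f) (yf : y \notin pimage f).
Hypothesis zw : z != w.

Lemma split_at_in_monoid : in_monoid S (split_at f x w).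
Proof.
apply: in_monoidI => e p; last first.
  by rewrite ffunE; case: eqP => // _; exact: (in_monoid_total Sf e).
move=> p' q; rewrite !ffunE; do 2!case: eqP => [->|_] //.
- by move=> [<-] /mem_pimage; rewrite (negPf wf).
- by move=> /mem_pimage + [qw]; rewrite -qw (negPf wf).
- exact: (in_monoid_inj Sf e).
Qed.

Lemma pimage_split_at : pimage (split_at f x w) = w |: pimage f.
Proof.
apply/setP => q; rewrite in_setU1; apply/pimageP/orP => [[p]|[/eqP->|/pimageP[p fp]]].
- by rewrite ffunE; case: eqP => [_ [<-]|_ /mem_pimage]; [left|right].
- by exists x; rewrite ffunE eqxx.
have [px|px] := eqVneq p x; last by exists p; rewrite ffunE (negPf px).
case: fx => [fxN|[x' nx fx']]; first by rewrite px fxN in fp.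
by exists x'; rewrite ffunE (negPf nx) fx' -px.
Qed.

Lemma rank_split_at : rank (split_at f x w) = (rank f).+1.
Proof. exact: rank_setU1 pimage_split_at wf. Qed.

Lemma split_at_ideal : rank f < m -> I (split_at f x w).
Proof. by move=> fm; apply/andP; split; [apply: split_at_in_monoid|rewrite rank_split_at]. Qed.

Lemma retract_with_in_monoid : in_monoid S (retract_with f x z y).
Proof.
apply: in_monoidI => e p; last first.
  rewrite ffunE; case: ifP => // _; case: ifP => // _; exact: (in_monoid_total Sf e).
have fxN := non_isolated_inj Sf e fx.
move=> p' q; rewrite !ffunE fxN.
case: (boolP (p \in _)) => pf; case: (boolP (p' \in _)) => p'f //.
- by move=> [<-] [].
- by case: eqP => // _ [<-] [yp]; move: yf; rewrite yp pf.
- by case: eqP => // _ [<-] [yp]; move: yf; rewrite -yp p'f.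
by case: eqP => [->|_] // _; case: eqP => [->|].
Qed.

Lemma pimage_retract_with : pimage (retract_with f x z y) = y |: pimage f.
Proof.
apply/setP => q; rewrite in_setU1; apply/pimageP/orP => [[p]|[/eqP->|qf]].
- rewrite ffunE; case: ifP => [pf [<-]|_]; first by right.
  by case: eqP => [_ [<-]|_ /mem_pimage]; [left|right].
- by exists z; rewrite ffunE (negPf zf) eqxx.
by exists q; rewrite ffunE qf.
Qed.

Lemma rank_retract_with : rank (retract_with f x z y) = (rank f).+1.
Proof. exact: rank_setU1 pimage_retract_with yf. Qed.

Lemma retract_with_ideal : rank f < m -> I (retract_with f x z y).
Proof.
by move=> fm; apply/andP; split; [apply: retract_with_in_monoid|rewrite rank_retract_with].
Qed.

Lemma split_at_retract : split_at f x w * retract_with f x z y = f.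
Proof.
apply/ffunP => p; rewrite ptrans_mulE ffunE; case: eqP => [->|_] /=.
  by rewrite ffunE (negPf wf) eq_sym (negPf zw).
by case fp: (f p) => [q|] //=; rewrite ffunE (mem_pimage fp).
Qed.

End Canonical.

(** * Connectedness of the factorizations of an element of rank [k] *)

Section Connectivity.
Hypotheses (k2m : k.+1 < m) (k3n : k.+2 < n) (nk2m : (n + k < 2 * m)%N).
(** [F] is an arbitrary invariant of moving a middle factor. It is later the congruence class of a
    word for [b] times a word for [c]. *)
Variables (X : Type) (F : ptrans n -> ptrans n -> X).
Hypothesis F_shift : forall b d c, I b -> I d -> I c ->
  k < rank (b * d) -> k < rank (d * c) -> F (b * d) c = F b (d * c).

(** [c] is replaced by [d * c], where [d] fixes the image of [b] and one further point [z], which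
    [c] sends outside the image of [b * c]. Then [b * d = b], while [d * c] has rank only [k.+1]. *)
Lemma reduce_right b c : I b -> I c -> rank (b * c) = k -> k < rank c ->
  k < rank b < m ->
  exists c', [/\ I c', rank c' = k.+1, b * c' = b * c & F b c = F b c'].
Proof.
move=> Ib Ic bck kc /andP[kb bm].
have [|z [y [cz ybc zb]]] := @rank_mul_lt b c; first by rewrite bck.
(* [d] has rank one more than [b], whence the hypothesis [rank b < m]. *)
pose e := if S is FullTransf then Some z else None.
pose d : ptrans n := [ffun p => if (p \in pimage b) || (p == z) then Some p else e].
have bd : b * d = b.
  apply/ffunP => x; rewrite ptrans_mulE; case bx: (b x) => [p|] //=.
  by rewrite ffunE (mem_pimage bx).
have dP p q : d p = Some q -> q \in z |: pimage b.
  rewrite ffunE in_setU1 orbC; case: ifP => [pb [<-] //|_].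
  by rewrite /e; case: S => // -[<-]; rewrite eqxx.
have Id : I d.
  apply/andP; split.
    apply: in_monoidI => eS p; last by rewrite ffunE /e eS; case: ifP.
    by move=> p' q; rewrite !ffunE /e eS; do 2!case: ifP => // _; move=> [<-] [].
  by apply: leq_trans (rank_le_card dP) _; rewrite cardsU1 zb.
have dc : pimage (d * c) = y |: pimage (b * c).
  apply/setP => q; rewrite in_setU1; apply/pimage_mul/orP => [[p /pimageP[p' /dP]]|].
    rewrite in_setU1 => /orP[/eqP->|pb cp]; first by rewrite cz => -[->]; left.
    by right; apply/pimage_mul; exists p.
  case=> [/eqP->|/pimage_mul[p pb cp]].
    by exists z => //; apply: (@mem_pimage _ _ z); rewrite ffunE eqxx orbT.
  by exists p => //; apply: (@mem_pimage _ _ p); rewrite ffunE pb.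
have rdc : rank (d * c) = k.+1 by rewrite (rank_setU1 dc ybc) -/(rank _) bck.
exists (d * c); split=> //; first exact: rank_ideal_mul_closed.
  by rewrite mulgA bd.
by rewrite -{1}bd F_shift ?bd ?rdc.
Qed.

(** Dually, [b] is replaced by [b * d], where [d * c = c] and [d] maps the image of [b] onto a set
    of [k.+1] points. *)
Lemma reduce_left b c : I b -> I c -> rank (b * c) = k -> k < rank b ->
  k < rank c < m ->
  exists b', [/\ I b', rank b' = k.+1, b' * c = b * c & F b c = F b' c].
Proof.
move=> Ib Ic bck kb /andP[kc cm].
(* [s] is a section of [c]. Over the image of [b * c] its values are taken in the image of [b], so
   that [b * d] reaches them. *)
have /(@fin_all_exists _ _ (fun y s => y \in pimage c -> c s = Some y /\
    (y \in pimage (b * c) -> s \in pimage b)))[s sP] (y : 'I_n) : exists s,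
    y \in pimage c -> c s = Some y /\ (y \in pimage (b * c) -> s \in pimage b).
  case: (boolP (y \in pimage (b * c))) => [/pimage_mul[p pb cp]|_]; first by exists p.
  case: (boolP (y \in pimage c)) => [/pimageP[p cp]|_]; last by exists y.
  by exists p.
have bcc y : y \in pimage (b * c) -> y \in pimage c by move/(subsetP (pimage_mulr _ _)).
have sinj : {in pimage (b * c) &, injective s}.
  move=> y y' /bcc/sP[cs _] /bcc/sP[cs' _] ss; move: cs; rewrite ss cs'.
  by case.
have /subsetPn[z zb zs] : ~~ (pimage b \subset s @: pimage (b * c)).
  by apply/negP => /subset_leq_card; rewrite (card_in_imset sinj) leqNgt -!/(rank _) bck kb.
(* [d] retracts onto a section of [c], but also fixes [z]; its rank is one more than that of [c]. *)
pose d : ptrans n := [ffun p => if p == z then Some z else omap s (c p)].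
have dc : d * c = c.
  apply/ffunP => p; rewrite ptrans_mulE ffunE; case: eqP => [->|_] //=.
  by case cp: (c p) => [y|] //=; case: (sP y (mem_pimage cp)).
have Id : I d.
  have [Sc _] := andP Ic.
  apply/andP; split; last first.
    apply: leq_trans (rank_le_card (C := z |: s @: pimage c) _) _.
      move=> p q; rewrite ffunE in_setU1; case: eqP => [_ [<-]|_]; first by rewrite eqxx.
      case cp: (c p) => [y|] //= [<-]; rewrite imset_f ?orbT //; exact: mem_pimage cp.
    rewrite cardsU1; apply: leq_trans cm; rewrite -add1n leq_add ?leq_b1 //.
    exact: leq_imset_card.
  apply: in_monoidI => eS; last first.
    by move=> p; rewrite ffunE; case: eqP => // _; have := in_monoid_total Sc eS p; case: (c p).
  have sc p y : c p = Some y -> s y = p.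
    move=> cp; have [cs _] := sP y (mem_pimage cp).
    exact: in_monoid_inj Sc eS _ _ _ cs cp.
  have cz : c z = None.
    case cz: (c z) => [y|] //; case/imsetP: zs; exists y; last by rewrite (sc z).
    by apply/pimage_mul; exists z.
  move=> p p' q; rewrite !ffunE; case: eqP => [->|_]; case: eqP => [->|_] //.
  - by move=> [<-]; case cp': (c p') => [y|] //= [sy]; move: (cp'); rewrite -(sc _ _ cp') sy cz.
  - by case cp: (c p) => [y|] //= + [zq]; rewrite -zq => -[sy]; move: (cp); rewrite -(sc _ _ cp) sy cz.
  case cp: (c p) => [y|] //=; case cp': (c p') => [y'|] //=.
  by rewrite (sc _ _ cp) (sc _ _ cp') => -[->] [].
have bd : pimage (b * d) = z |: s @: pimage (b * c).
  apply/setP => q; rewrite in_setU1; apply/pimage_mul/orP => [[p pb]|].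
    rewrite ffunE; case: eqP => [_ [<-]|_]; first by left.
    case cp: (c p) => [y|] //= [<-]; right; apply: imset_f.
    by apply/pimage_mul; exists p.
  case=> [/eqP->|/imsetP[y ybc ->]]; first by exists z; rewrite // ffunE eqxx.
  have [cs sb] := sP y (bcc _ ybc); exists (s y); first exact: sb.
  rewrite ffunE cs; case: eqP => //= syz.
  by rewrite -syz (imset_f s ybc) in zs.
have rbd : rank (b * d) = k.+1.
  by rewrite (rank_setU1 bd zs) (card_in_imset sinj) -/(rank _) bck.
exists (b * d); split=> //; first exact: rank_ideal_mul_closed.
  by rewrite -mulgA dc.
by rewrite F_shift ?dc ?rbd.
Qed.

(** Sylvester's inequality: the image points of [g] missing from that of [f * g] have distinct
    preimages, all outside the image of [f]. *)
Lemma rank_mul_ge f g : rank f + rank g <= n + rank (f * g).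
Proof.
have : #|pimage g :\: pimage (f * g)| <= #|~: pimage f|.
  rewrite -(card_Some_imset (pimage g :\: _)).
  apply: leq_trans (leq_imset_card g _); apply/subset_leq_card/subsetP.
  move=> _ /imsetP[y + ->]; rewrite in_setD => /andP[fgy /pimageP[x gx]].
  rewrite -gx; apply: imset_f; rewrite in_setC; apply: contra fgy => fx.
  by apply/pimage_mul; exists x.
have := cardsC (pimage f); rewrite card_ord cardsD (setIidPr (pimage_mulr f g)) /rank.
lia.
Qed.

(** If [x] is not yet alone in its kernel class, [b] is split there as [b' * d], with [b'] sending
    only [x] to the new point [w], and [d] is moved over to [c]. *)
Lemma isolate b c x : I b -> I c -> rank (b * c) = k -> rank b = k.+1 ->
    rank c = k.+1 -> non_isolated (b * c) x ->
  exists b' c', [/\ I b', I c', k < rank b' & rank c' = k.+1] /\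
    [/\ b' * c' = b * c, F b c = F b' c' & exists u, b' x = Some u /\ (forall x', b' x' = Some u -> x' = x)].
Proof.
move=> Ib Ic bck rb rc bcx; have [Sb bm] := andP Ib.
have [iso|niso] := pselect (exists u, b x = Some u /\ forall x', b x' = Some u -> x' = x).
  by exists b, c; do 2!split=> //; rewrite rb.
have bx : non_isolated b x.
  case bx: (b x) => [u|]; last by left.
  right; apply: contrapT => no; apply: niso; exists u; split => // x' bx'.
  by apply/eqP; apply: contrapT => /negP nx; apply: no; exists x'; rewrite ?bx.
have [|z [y [cz ybc zb]]] := @rank_mul_lt b c; first by rewrite bck rc.
(* Besides [z], a second point outside the image of [b] is needed; it exists because [rank b = k.+1]
   and [k.+2 < n]. *)
have /subsetPn[w _ wbz] : ~~ (setT \subset z |: pimage b).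
  apply/negP => /subset_leq_card; rewrite cardsT card_ord cardsU1 zb -/(rank b) rb.
  by rewrite leqNgt k3n.
move: wbz; rewrite in_setU1 negb_or => /andP[wz wb].
have zw : z != w by rewrite eq_sym.
pose b' := split_at b x w; pose d := retract_with b x z z.
have b'd : b' * d = b by apply: split_at_retract.
have Ib' : I b' by apply: split_at_ideal => //; rewrite rb.
have Id : I d by apply: retract_with_ideal => //; rewrite rb.
have dc : pimage (d * c) = y |: pimage (b * c).
  apply/eqP; rewrite eq_sym eqEcard; apply/andP; split; last first.
    by rewrite cardsU1 ybc -/(rank (b * c)) bck; apply: leq_trans (rank_mulr _ _) _; rewrite rc.
  rewrite -{1}b'd -mulgA subUset sub1set pimage_mulr andbT.
  by apply/pimageP; exists z; rewrite ptrans_mulE ffunE (negPf zb) eqxx.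
have rdc : rank (d * c) = k.+1 by rewrite (rank_setU1 dc ybc) -/(rank _) bck.
exists b', (d * c); do 2!split=> //.
- exact: rank_ideal_mul_closed.
- by rewrite rank_split_at // rb.
- by rewrite mulgA b'd.
- by rewrite -{1}b'd F_shift // ?b'd ?rb ?rdc.
exists w; split; first by rewrite ffunE eqxx.
by move=> x'; rewrite ffunE; case: eqP => // _ /mem_pimage; rewrite (negPf wb).
Qed.

Section Normalize.
Variables (f : ptrans n) (x z w : 'I_n).
Hypotheses (If : I f) (fk : rank f = k) (fx : non_isolated f x).
Hypotheses (wf : w \notin pimage f) (zf : z \notin pimage f) (zw : z != w).

Let Sf : in_monoid S f. Proof. by case/andP: If. Qed.
Let Isplit : I (split_at f x w).
Proof. by apply: split_at_ideal => //; rewrite fk ltnW. Qed.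

(** The middle factor [d] satisfies [b * d = split_at f x w] and [d * g = c]. It sends [u] to [w],
    which affects only [x] since [u] has no other preimage under [b], and sends the preimages of [y]
    under [c] to [z]. *)
Lemma normalize_left b c g u y : I b -> I c -> b * c = f -> k < rank b ->
    rank c = k.+1 -> b x = Some u -> (forall x', b x' = Some u -> x' = x) ->
    y \in pimage c -> y \notin pimage f ->
    I g -> (forall p, p \in pimage f -> g p = Some p) -> g w = f x -> g z = Some y ->
  F b c = F (split_at f x w) g.
Proof.
move=> Ib Ic bcf kb rc bx xP yc yf Ig gf gw gz.
have cE : pimage c = y |: pimage f.
  apply/esym/eqP; rewrite eqEcard subUset sub1set yc -bcf pimage_mulr /=.
  by move: fk rc; rewrite cardsU1 bcf yf /rank => -> ->.
have cu : c u = f x by rewrite -bcf ptrans_mulE bx.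
pose d : ptrans n :=
  [ffun p => if p == u then Some w else if c p == Some y then Some z else c p].
have dg : d * g = c.
  apply/ffunP => p; rewrite ptrans_mulE ffunE; case: eqP => [->|_] /=; first by rewrite gw cu.
  case: eqP => [->|cp] //=; case cq: (c p) => [q|] //=; apply: gf.
  have := mem_pimage cq; rewrite cE in_setU1 => /orP[/eqP qy|//].
  by rewrite cq qy in cp.
have bd : b * d = split_at f x w.
  apply/ffunP => p; rewrite ptrans_mulE ffunE; have [->|/eqP px] := eqVneq p x.
    by rewrite bx /= ffunE eqxx.
  rewrite -bcf ptrans_mulE; case bp: (b p) => [q|] //=; rewrite ffunE.
  have [qu|_] := eqVneq q u; first by case: px; apply: xP; rewrite bp qu.
  case: eqP => // cq; case/negP: yf; rewrite -bcf.
  by apply: (@mem_pimage _ _ p); rewrite ptrans_mulE bp.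
have dP p q : d p = Some q -> q \in w |: (z |: pimage f).
  rewrite ffunE !in_setU1; case: eqP => [_ [<-]|_]; first by rewrite eqxx.
  case: eqP => [_ [<-]|cp cq]; first by rewrite eqxx orbT.
  have := mem_pimage cq; rewrite cE in_setU1 => /orP[/eqP qy|->]; last by rewrite !orbT.
  by rewrite cq qy in cp.
have [Sc _] := andP Ic.
have Id : I d.
  apply/andP; split; last first.
    apply: leq_trans (rank_le_card dP) (leq_trans (card_setU2_le _ _ _) _).
    by rewrite -/(rank f) fk.
  apply: in_monoidI => eS; last first.
    move=> p; rewrite ffunE; case: eqP => // _; case: eqP => // _.
    exact: in_monoid_total Sc eS p.
  have fxN := non_isolated_inj Sf eS fx.
  have cw p : c p = Some w -> c p <> Some y -> False.
    move=> cp cy; have := mem_pimage cp; rewrite cE in_setU1 (negPf wf) orbF => /eqP wy.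
    by case: cy; rewrite cp wy.
  have cz p : c p = Some z -> c p <> Some y -> False.
    move=> cp cy; have := mem_pimage cp; rewrite cE in_setU1 (negPf zf) orbF => /eqP zy.
    by case: cy; rewrite cp zy.
  move=> p p' q; rewrite !ffunE.
  case: (p =P u) => [->|pu]; case: (p' =P u) => [->|p'u] //.
  - move=> [<-]; case: eqP => [_ [zw']|]; first by case/eqP: zw.
    by move=> + cp; case/(cw _ cp).
  - case: eqP => [_ [<-] [zw']|]; first by case/eqP: zw.
    by move=> + cp [wq]; rewrite -wq in cp; case/(cw _ cp).
  case: (c p =P Some y) => cp; case: (c p' =P Some y) => cp'.
  - by move=> _ _; apply: in_monoid_inj Sc eS _ _ _ cp cp'.
  - by move=> [<-] cz'; case: (cz _ cz' cp').
  - by move=> + [zq]; rewrite -zq => cz'; case: (cz _ cz' cp).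
  exact: in_monoid_inj Sc eS _ _ _.
by rewrite -bd -{1}dg F_shift // ?dg ?rc // bd rank_split_at // fk.
Qed.

(** Here [d] fixes the image of [split_at f x w] and sends [z] to [t], so that [d * g] takes the
    value [y] at [z]. *)
Lemma normalize_right g y t : I g -> (forall p, p \in pimage f -> g p = Some p) ->
    g w = f x -> g t = Some y -> y \notin pimage f -> t \notin pimage f -> t != w ->
  F (split_at f x w) g = F (split_at f x w) (retract_with f x z y).
Proof.
move=> Ig gf gw gt yf tf tw.
pose d : ptrans n := [ffun p => if (p == w) || (p \in pimage f) then Some p
                                else if p == z then Some t else f x].
have sd : split_at f x w * d = split_at f x w.
  apply/ffunP => p; rewrite ptrans_mulE ffunE; case: eqP => _ /=.
    by rewrite ffunE eqxx.
  by case fp: (f p) => [q|] //=; rewrite ffunE (mem_pimage fp) orbT.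
have gfx : obind g (f x) = f x.
  by case fxq: (f x) => [q|] //=; rewrite gf //; apply: mem_pimage fxq.
have dg : d * g = retract_with f x z y.
  apply/ffunP => p; rewrite ptrans_mulE !ffunE; have [->|pw] /= := eqVneq p w.
    by rewrite (negPf wf) eq_sym (negPf zw).
  by case: ifP => [pf|_] /=; [rewrite gf | case: ifP => //= _; rewrite gt].
have Id : I d.
  apply/andP; split; last first.
    apply: leq_trans (rank_le_card (C := t |: (w |: pimage f)) _)
                     (leq_trans (card_setU2_le _ _ _) _); last by rewrite -/(rank f) fk.
      move=> p q; rewrite ffunE !in_setU1; case: ifP => [pwf [<-]|_]; first by rewrite pwf orbT.
      by case: ifP => [_ [<-]|_ /mem_pimage ->]; rewrite ?eqxx ?orbT.
  apply: in_monoidI => eS p; last first.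
    by rewrite ffunE; case: ifP => // _; case: ifP => // _; apply: in_monoid_total Sf eS x.
  have tP : (t == w) || (t \in pimage f) = false by rewrite (negPf tw) (negPf tf).
  move=> p' q; rewrite !ffunE (non_isolated_inj Sf eS fx).
  case: (boolP ((p == w) || _)) => pP; case: (boolP ((p' == w) || _)) => p'P.
  - by move=> [<-] [].
  - by case: eqP => // _ [<-] [tp]; rewrite -tp tP in pP.
  - by case: eqP => // _ [<-] [tp]; rewrite tp tP in p'P.
  by case: eqP => [->|_] // _; case: eqP => [->|].
have Ir : I (retract_with f x z y).
  by apply: retract_with_ideal => //; rewrite fk ltnW.
by rewrite -dg -{1}sd F_shift // ?dg ?sd ?rank_retract_with ?rank_split_at // fk.
Qed.

(** The extra image point [y0] of [c] may differ from the prescribed [y]. The map [g] then has both,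
    [y0] at [z] and [y] at a third point [v]: [normalize_left] leads to [g], and [normalize_right]
    trades [y0] for [y]. *)
Lemma normalize b c u y : I b -> I c -> b * c = f -> k < rank b -> rank c = k.+1 ->
    b x = Some u -> (forall x', b x' = Some u -> x' = x) -> y \notin pimage f ->
  F b c = F (split_at f x w) (retract_with f x z y).
Proof.
move=> Ib Ic bcf kb rc bx xP yf.
have [|_ [y0 [/mem_pimage y0c y0f _]]] := @rank_mul_lt b c; first by rewrite bcf fk rc.
rewrite bcf in y0f.
have gE y' p : p \in pimage f -> retract_with f x z y' p = Some p by move=> pf; rewrite ffunE pf.
have gw y' : retract_with f x z y' w = f x.
  by rewrite ffunE (negPf wf) eq_sym (negPf zw).
have [y0y|y0y] := eqVneq y0 y.
  apply: normalize_left bx xP _ yf _ _ _ _ => //; rewrite -?y0y //.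
  - by apply: retract_with_ideal => //; rewrite fk ltnW.
  - exact: gE.
  by rewrite ffunE (negPf zf) eqxx.
have /subsetPn[v _ vP] : ~~ (setT \subset z |: (w |: pimage f)).
  apply/negP => /subset_leq_card; rewrite cardsT card_ord => nC.
  have := leq_trans nC (card_setU2_le _ _ _).
  by rewrite -/(rank f) fk leqNgt k3n.
move: vP; rewrite !in_setU1 !negb_or => /and3P[vz vw vf].
pose g : ptrans n := [ffun p => if p \in pimage f then Some p else
  if p == z then Some y0 else if p == v then Some y else f x].
have Ig : I g.
  apply/andP; split; last first.
    apply: leq_trans (rank_le_card (C := y0 |: (y |: pimage f)) _)
                     (leq_trans (card_setU2_le _ _ _) _); last by rewrite -/(rank f) fk.
      move=> p q; rewrite ffunE !in_setU1; case: ifP => [pf [<-]|_]; first by rewrite pf !orbT.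
      case: ifP => [_ [<-]|_]; rewrite ?eqxx //.
      by case: ifP => [_ [<-]|_ /mem_pimage ->]; rewrite ?eqxx ?orbT.
  apply: in_monoidI => eS p; last first.
    rewrite ffunE; do 3!case: ifP => // _; exact: in_monoid_total Sf eS x.
  move=> p' q; rewrite !ffunE (non_isolated_inj Sf eS fx).
  case: (boolP (p \in _)) => pP; case: (boolP (p' \in _)) => p'P.
  - by move=> [<-] [].
  - case: eqP => [_ [<-] [e]|_]; first by rewrite e pP in y0f.
    by case: eqP => // _ [<-] [e]; rewrite e pP in yf.
  - case: eqP => [_ [<-] [e]|_]; first by rewrite -e p'P in y0f.
    by case: eqP => // _ [<-] [e]; rewrite -e p'P in yf.
  case: (p =P z) => [->|_]; case: (p' =P z) => [->|_] //.
  - by move=> [<-]; case: eqP => // _ [e]; rewrite e eqxx in y0y.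
  - by case: eqP => // _ [<-] [e]; rewrite e eqxx in y0y.
  by case: eqP => [->|_] // _; case: eqP => [->|].
have gf p : p \in pimage f -> g p = Some p by move=> pf; rewrite ffunE pf.
have gw' : g w = f x.
  by rewrite ffunE (negPf wf) eq_sym (negPf zw) eq_sym (negPf vw).
rewrite (normalize_left Ib Ic bcf kb rc bx xP y0c y0f Ig gf gw'); last first.
  by rewrite ffunE (negPf zf) eqxx.
have gv : g v = Some y by rewrite ffunE (negPf vf) (negPf vz) eqxx.
exact: normalize_right Ig gf gw' gv yf vf vw.
Qed.

End Normalize.

(** The right-hand side depends only on the product and on the auxiliary points, so [F] agrees on
    all factorizations of an element through ranks above [k]. *)
Lemma shift_invariant_canonical b c x y z w : I b -> I c -> rank (b * c) = k ->
    k < rank b -> k < rank c -> non_isolated (b * c) x ->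
    w \notin pimage (b * c) -> z \notin pimage (b * c) -> z != w ->
    y \notin pimage (b * c) ->
  F b c = F (split_at (b * c) x w) (retract_with (b * c) x z y).
Proof.
move=> Ib Ic bck kb kc fx wf zf zw yf.
have If : I (b * c) by apply: rank_ideal_mul_closed.
have [f bcf] : exists f, b * c = f by exists (b * c).
rewrite bcf in If bck fx wf zf yf *; rename bck into fk.
have [_ bm] := andP Ib; have [_ cm] := andP Ic.
have {}fk' : rank (b * c) = k by rewrite bcf.
(* If [c] has rank [m], then [rank_mul_ge] and [n + k < 2 * m] force [rank b < m], as [reduce_right]
   requires. *)
wlog {cm} cm : c Ic bcf kc fk' / rank c < m.
  move=> W; move: cm; rewrite leq_eqVlt => /orP[/eqP cm|]; last exact: W.
  have [|c' [Ic' rc' bc' ->]] := reduce_right Ib Ic fk' kc.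
    by have := rank_mul_ge b c; rewrite kb cm fk' /=; lia.
  by apply: W => //; rewrite ?bc' ?rc' //; lia.
wlog rb : b Ib bcf kb bm fk' / rank b = k.+1.
  move=> W; have [|b' [Ib' rb' bc' ->]] := reduce_left Ib Ic fk' kb; first by rewrite kc.
  by apply: W => //; rewrite ?bc' ?rb' //; lia.
(* The rank of [c] may still exceed [k.+1]; it can be lowered now that [b] has rank [k.+1 < m]. *)
wlog rc : c Ic bcf kc fk' cm / rank c = k.+1.
  move=> W; have [|c' [Ic' rc' bc' ->]] := reduce_right Ib Ic fk' kc; first by rewrite rb; lia.
  by apply: W => //; rewrite ?bc' ?rc' //; lia.
have [|b' [c' [[Ib' Ic' kb' rc'] [bc' -> [u [bx xP]]]]]] := isolate (x := x) Ib Ic fk' rb rc.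
  by rewrite bcf.
by apply: normalize Ib' Ic' _ kb' rc' bx xP _ => //; rewrite bc'.
Qed.

End Connectivity.
End Factorizations.

(** * The presentation by generators and relations of rank at least r *)

Section Evaluation.
Variables (A : Type) (n : nat) (phi : A -> ptrans n).
Local Open Scope group_scope.

(** The empty sequence gets the identity, which need not lie in the ideal, so that a word can be cut
    at either end. *)
Definition eval (s : seq A) : ptrans n := foldr (fun a f => phi a * f) (ptrans_id n) s.

Lemma eval_cat s t : eval (s ++ t) = eval s * eval t.
Proof. by elim: s => [|a s IHs] /=; rewrite ?ptrans_mul1 // IHs mulgA. Qed.

Lemma eval_seq1 a : eval [:: a] = phi a.
Proof. exact: ptrans_mulf1. Qed.

Lemma eval_rcons s a : eval (rcons s a) = eval s * phi a.
Proof. by rewrite -cats1 eval_cat eval_seq1. Qed.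

Lemma eval_ideal S m s : (forall a, rank_ideal_pred S m (phi a)) -> s <> [::] ->
  rank_ideal_pred S m (eval s).
Proof.
move=> phiI; elim: s => // a [|b s] IHs _; first by rewrite eval_seq1.
by apply: rank_ideal_mul_closed; [apply: phiI | apply: IHs].
Qed.

End Evaluation.

Section Presentation.
Variables (S : transf_monoid) (n m r : nat).
Local Open Scope group_scope.
Local Notation I := (@rank_ideal_pred S n m).

Definition letter := {f : ptrans n | I f && (r <= rank f)}.
HB.instance Definition _ := SubType.on letter.
HB.instance Definition _ := Finite.on letter.

Definition word_value (u : word letter) : ptrans n := eval val (val u).

Definition shallow_rel (u v : word letter) : Prop :=
  word_value u = word_value v /\ r <= rank (word_value u).

Lemma word_valueM u v : word_value (u * v) = word_value u * word_value v.
Proof. exact: eval_cat. Qed.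

Lemma letter_ideal (a : letter) : I (val a).
Proof. by case/andP: (valP a). Qed.

Lemma word_value_ideal u : I (word_value u).
Proof. by apply: eval_ideal; [apply: letter_ideal | apply/eqP/(valP u)]. Qed.

Lemma congruence_word_value u v : congruence shallow_rel u v -> word_value u = word_value v.
Proof.
elim=> {u v} [u v []||u v _ ->|u v w _ -> _ ->|u u' v v' _ eu _ ev] //.
by rewrite !word_valueM eu ev.
Qed.

Hypothesis shallow_bounds : forall k, min_rank S <= k < r ->
  [/\ k.+1 < m, k.+2 < n & (n + k < 2 * m)%N].
Hypothesis n_gt0 : 0 < n.

Lemma ideal_bounds f : I f -> rank f < r ->
  [/\ (rank f).+1 < m, (rank f).+2 < n & (n + rank f < 2 * m)%N].
Proof.
by move=> /andP[Sf _] fr; apply: shallow_bounds; rewrite fr andbT min_rank_le.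
Qed.

Lemma canonical_data_ex (f : ptrans n) : (rank f).+2 < n ->
  exists x w z, [/\ non_isolated f x, w \notin pimage f, z \notin pimage f & z != w].
Proof.
move=> fn; have [|x fx] := @non_isolated_ex _ f; first by lia.
have /subsetPn[w _ wf] : ~~ (setT \subset pimage f).
  by apply/negP => /subset_leq_card; rewrite cardsT card_ord -/(rank f); lia.
have /subsetPn[z _] : ~~ (setT \subset w |: pimage f).
  by apply/negP => /subset_leq_card; rewrite cardsT card_ord cardsU1 wf -/(rank f); lia.
by rewrite in_setU1 negb_or => /andP[zw zf]; exists x, w, z.
Qed.

Lemma letter_word f (fL : I f && (r <= rank f)) :
  exists u, word_value u = f.
Proof. by exists (Sub [:: Sub f fL] isT); apply: ptrans_mulf1. Qed.

(** Downward induction on the rank: below [r], [split_at] and [retract_with] factor [f] through rank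
    one more. *)
Lemma word_value_surj f : I f -> exists u, word_value u = f.
Proof.
have [j] := ubnP (r - rank f); elim: j f => // j IHj f fj If.
have [rf|fr] := leqP r (rank f); first by apply: letter_word; rewrite If.
have [fm fn _] := ideal_bounds If fr; have [Sf _] := andP If.
have [x [w [z [fx wf zf zw]]]] := canonical_data_ex fn.
have [||u eu] := IHj (split_at f x w).
- by rewrite rank_split_at //; lia.
- by apply: split_at_ideal => //; apply: ltnW.
have [||v ev] := IHj (retract_with f x z w).
- by rewrite rank_retract_with //; lia.
- by apply: retract_with_ideal => //; apply: ltnW.
by exists (u * v); rewrite word_valueM eu ev split_at_retract.
Qed.

(** * The inductive step from ranks above [k] to rank [k] *)

Section Descent.
Variable k : nat.
Hypotheses (kr : k < r) (km : k.+1 < m) (kn : k.+2 < n) (nkm : (n + k < 2 * m)%N).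
Hypothesis deep : forall u v, word_value u = word_value v -> k < rank (word_value u) ->
  congruence shallow_rel u v.
Variable W : ptrans n -> word letter.
Hypothesis WE : forall f, I f -> word_value (W f) = f.

Let F b c := cong_class shallow_rel (W b * W c).

Lemma congruence_W_mul b c : I b -> I c -> k < rank (b * c) ->
  congruence shallow_rel (W (b * c)) (W b * W c).
Proof.
move=> Ib Ic bc; have Ibc : I (b * c) by apply: rank_ideal_mul_closed.
by apply: deep; rewrite ?word_valueM !WE.
Qed.

Lemma W_shift b d c : I b -> I d -> I c -> k < rank (b * d) -> k < rank (d * c) ->
  F (b * d) c = F b (d * c).
Proof.
move=> Ib Id Ic bd dc; apply/cong_classP.
apply: cong_trans (cong_mul (congruence_W_mul Ib Id bd) (cong_refl _ _)) _.
rewrite -mulgA; apply: cong_mul (cong_refl _ _) (cong_sym (congruence_W_mul Id Ic dc)).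
Qed.

(** Induction on the length, removing the last letter [a]. If the remaining word has rank above [k],
    it forms with [a] a factorization to which [shift_invariant_canonical] applies. Otherwise it is
    first rewritten by induction, with a suitable [y]. *)
Lemma class_canonical (s : seq letter) (s0 : s != [::]) x y z w : let f := eval val s in
    rank f = k -> non_isolated f x -> w \notin pimage f -> z \notin pimage f -> z != w ->
    y \notin pimage f ->
  cong_class shallow_rel (Sub s s0) = F (split_at f x w) (retract_with f x z y).
Proof.
elim/last_ind: s s0 x y z w => // s a IHs sa0 x y z w /=.
have rk_a : k < rank (val a) by have /andP[_] := valP a; apply: leq_trans.
have Ia := letter_ideal a.
rewrite eval_rcons.
have [s0|s0] := eqVneq s [::].
  by rewrite {1}s0 /= ptrans_mul1 => ak; rewrite ak ltnn in rk_a.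
pose us : word letter := Sub s s0; pose ua : word letter := Sub [:: a] isT.
have -> : Sub (rcons s a) sa0 = us * ua by apply: val_inj; rewrite /= cats1.
have If : I (eval val s) by apply: (word_value_ideal us).
have Wa : congruence shallow_rel ua (W (val a)).
  have ua_val : word_value ua = val a by apply: ptrans_mulf1.
  by apply: deep; rewrite ua_val ?WE.
set f := eval val s in If *; move=> fak fx wf zf zw yf.
have fk : k <= rank f by rewrite -fak rank_mull.
rewrite leq_eqVlt in fk; case/orP: fk => [/eqP fk|fk]; last first.
  rewrite -(shift_invariant_canonical km kn nkm W_shift If Ia) //.
  by apply/cong_classP/cong_mul => //; apply: deep; rewrite ?WE.
(* [q] becomes the extra image point of the second factor [c]. As [val a] sends it to [p], outside
   the image of [f * val a], the product [c * val a] has rank above [k]. *)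
have [|q [p [ap fap qf]]] := @rank_mul_lt _ f (val a); first by rewrite fak.
have fn : (rank f).+2 < n by rewrite -fk.
have [x' [w' [z' [fx' wf' zf' zw']]]] := canonical_data_ex fn.
have := IHs s0 x' q z' w' (esym fk) fx' wf' zf' zw' qf => /cong_classP us_eq.
rewrite -/f in us_eq.
have [Sf _] := andP If.
set b := split_at _ _ _ in us_eq; set c := retract_with _ _ _ _ in us_eq.
have Ib : I b by apply: split_at_ideal => //; rewrite -fk ltnW.
have Ic : I c by apply: retract_with_ideal => //; rewrite -fk ltnW.
have bcf : b * c = f by apply: split_at_retract.
have kb : k < rank b by rewrite rank_split_at // -fk.
have kc : k < rank c by rewrite rank_retract_with // -fk.
have ca : k < rank (c * val a).
  rewrite -fak -bcf -mulgA; apply: proper_card; apply/properP.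
  split; first exact: pimage_mulr.
  exists p; last by rewrite mulgA bcf.
  apply/pimageP; exists z'; rewrite ptrans_mulE ffunE (negPf zf') eqxx; exact: ap.
have Ica : I (c * val a) by apply: rank_ideal_mul_closed.
have bca : b * (c * val a) = f * val a by rewrite mulgA bcf.
rewrite -bca -(shift_invariant_canonical km kn nkm W_shift Ib Ica) ?bca //.
apply/cong_classP; apply: cong_trans (cong_mul us_eq Wa) _.
by rewrite -mulgA; apply: cong_mul (cong_refl _ _) (cong_sym (congruence_W_mul Ic Ia ca)).
Qed.

End Descent.

(** Downward induction on the rank of the common value. From rank [r] on, the equality is a defining
    relation; below, both words equal the same canonical product. *)
Lemma word_value_inj u v : word_value u = word_value v -> congruence shallow_rel u v.
Proof.
have [W WE] : exists W : ptrans n -> word letter, forall f, I f -> word_value (W f) = f.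
  have /choice[W WE] : forall f, exists w, I f -> word_value w = f; last by exists W.
  by move=> f; have [/word_value_surj[w ew]|] := boolP (I f); [exists w | exists u].
have [j] := ubnP (r - rank (word_value u)); elim: j u v => // j IHj u v uj uv.
have [ru|ur] := leqP r (rank (word_value u)); first by apply: cong_rel; split.
have [km kn nkm] := ideal_bounds (word_value_ideal u) ur.
have deep u' v' : word_value u' = word_value v' ->
    rank (word_value u) < rank (word_value u') -> congruence shallow_rel u' v'.
  by move=> e ku; apply: IHj => //; lia.
have [x [w [z [fx wf zf zw]]]] := canonical_data_ex kn.
have can := class_canonical ur km kn nkm deep WE.
have class_u v' : word_value v' = word_value u -> cong_class shallow_rel v' =
    cong_class shallow_rel (W (split_at (word_value u) x w) * W (retract_with (word_value u) x z w)).
  by case: v' => s s0 vu; rewrite -vu in fx wf zf *; apply: can; rewrite // -vu.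
by apply/cong_classP; rewrite !class_u.
Qed.

End Presentation.

(** * J-classes and depth *)

Section JClasses.
Variables (S : transf_monoid) (n m : nat).
Hypothesis n_gt0 : 0 < n.
Local Open Scope group_scope.
Local Notation I := (@rank_ideal_pred S n m).
Local Notation T := (rank_ideal S n m).
Implicit Types (f g : ptrans n) (x y z : T).

Lemma inj_into_ex (C D : {set 'I_n}) : #|C| <= #|D| ->
  exists phi : 'I_n -> 'I_n, {in C &, injective phi} /\ {in C, forall p, phi p \in D}.
Proof.
move=> CD; pose phi p := nth p (enum D) (index p (enum C)).
have iC p : p \in C -> index p (enum C) < size (enum D).
  by move=> pC; rewrite -cardE; apply: leq_trans CD; rewrite cardE index_mem mem_enum.
exists phi; split=> [p q pC qC|p pC]; last by rewrite -mem_enum mem_nth ?iC.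
rewrite /phi (set_nth_default q) ?iC // => /eqP.
rewrite nth_uniq ?enum_uniq ?iC // => /eqP e.
by rewrite -[p](nth_index p (s := enum C)) ?e ?nth_index ?mem_enum.
Qed.

(** An injection [phi] carries the image of [f] into that of [g]: [a] lifts it through [g] and [b]
    undoes it. Both have rank at most [rank f], hence lie in the ideal. *)
Lemma ideal_factor f g : I f -> I g -> rank f <= rank g ->
  exists a b, [/\ I a, I b & f = a * g * b].
Proof.
move=> /andP[Sf fm] /andP[Sg _] /inj_into_ex[phi [phi_inj phiP]].
have /fin_all_exists[t tP] p : exists s, p \in pimage f -> g s = Some (phi p).
  by have [/phiP/pimageP[s gs]|] := boolP (p \in pimage f); [exists s | exists p].
(* In the total case the default value must be an image point of [f], lest [b] gain rank. *)
pose e := if S is FullTransf then f (Ordinal n_gt0) else None.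
pose a : ptrans n := [ffun x => omap t (f x)].
pose b : ptrans n := [ffun q => if [pick p in pimage f | phi p == q] is Some p
                                then Some p else e].
have rb : rank b <= rank f.
  apply: rank_le_card => q p; rewrite ffunE; case: pickP => [p' /andP[p'f _] [<-] //|_].
  by rewrite /e; case: S => // /mem_pimage.
have ra : rank a <= rank f.
  apply: leq_trans (rank_le_card (C := t @: pimage f) _) (leq_imset_card _ _) => x q.
  by rewrite ffunE; case fx: (f x) => [p|] //= [<-]; apply/imset_f/mem_pimage/fx.
have t_inj : {in pimage f &, injective t}.
  move=> p q pf qf tpq; apply: phi_inj => //.
  by apply: Some_inj; rewrite -!tP // tpq.
exists a, b; split.
- apply/andP; split; last exact: leq_trans fm.
  apply: in_monoidI => eS x; last first.
    by rewrite ffunE; have := in_monoid_total Sf eS x; case: (f x).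
  move=> x' q; rewrite !ffunE; case fx: (f x) => [p|] //=; case fx': (f x') => [p'|] //=.
  move=> [<-] [/t_inj tpp]; apply: (in_monoid_inj Sf eS fx).
  by rewrite fx' tpp // (mem_pimage fx, mem_pimage fx').
- apply/andP; split; last exact: leq_trans fm.
  apply: in_monoidI => eS q; last first.
    by rewrite ffunE /e eS; case: pickP => // _; apply: in_monoid_total Sf eS _.
  move=> q' p; rewrite !ffunE /e eS; case: pickP => [p1 /andP[_ /eqP <-]|_] //.
  by case: pickP => [p2 /andP[_ /eqP <-]|_] // [<-] [->].
apply/ffunP => x; rewrite !ptrans_mulE ffunE; case fx: (f x) => [p|] //=.
have pf := mem_pimage fx; rewrite tP //= ffunE.
case: pickP => [p' /andP[p'f /eqP /phi_inj -> //]|/(_ p)].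
by rewrite pf eqxx.
Qed.

Lemma principal_idealP x y : reflect (exists a b : option T,
    x = let ay := if a is Some a then a * y else y in if b is Some b then ay * b else ay)
  (x \in principal_ideal y).
Proof.
apply: (iffP idP); rewrite /principal_ideal !in_setU in_set1.
  case/orP => [/orP[/orP[/eqP->|/imsetP[a _ ->]]|/imsetP[b _ ->]]|/imset2P[a b _ _ ->]].
  - by exists None, None.
  - by exists (Some a), None.
  - by exists None, (Some b).
  - by exists (Some a), (Some b).
case=> -[a|] [[b|] ->] /=; rewrite ?eqxx //; apply/orP.
- by right; apply: imset2_f; rewrite inE.
- by left; apply/orP; left; apply/orP; right; apply: imset_f; rewrite inE.
by left; apply/orP; right; apply: imset_f; rewrite inE.
Qed.

Lemma principal_ideal_sub x y :
  (principal_ideal x \subset principal_ideal y) = (rank (val x) <= rank (val y)).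
Proof.
apply/idP/idP => [/subsetP/(_ x)|xy].
  case/(_ _)/principal_idealP; first by apply/principal_idealP; exists None, None.
  move=> [a|] [[b|] ->] //=; rewrite ?rank_mulr //.
    by apply: leq_trans (rank_mull _ _) (rank_mulr _ _).
  exact: rank_mull.
have [a [b [Ia Ib xE]]] := ideal_factor (valP x) (valP y) xy.
have {}xE : x = (Sub a Ia : T) * y * (Sub b Ib : T) by apply: val_inj.
apply/subsetP => z /principal_idealP[c [d ->]]; apply/principal_idealP.
exists (Some (if c is Some c then c * (Sub a Ia : T) else Sub a Ia)).
exists (Some (if d is Some d then (Sub b Ib : T) * d else Sub b Ib)).
by rewrite xE; case: c d => [c|] [d|] /=; rewrite ?mulgA.
Qed.

Lemma J_classE x : J_class x = [set y : T | rank (val y) == rank (val x)].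
Proof.
by apply/setP => y; rewrite !inE eqEsubset !principal_ideal_sub -eqn_leq.
Qed.

Definition default_image : option 'I_n :=
  if S is FullTransf then Some (Ordinal n_gt0) else None.

Definition initial_retract j : ptrans n :=
  [ffun i : 'I_n => if i < j then Some i else default_image].

Lemma card_ord_lt N j : j <= N -> #|[set i : 'I_N | i < j]| = j.
Proof.
move=> jN; have inj : injective (widen_ord jN) by move=> a b [] /val_inj.
rewrite -[RHS]card_ord -(card_imset predT inj); apply: eq_card => i; rewrite inE; apply/idP/imsetP => [ij|[k _ ->] //=].
by exists (Ordinal ij) => //; apply: val_inj.
Qed.

Lemma initial_retract_in_monoid j : in_monoid S (initial_retract j).
Proof.
apply: in_monoidI => eS i; last by rewrite ffunE /default_image eS; case: ifP.
by move=> i' q; rewrite !ffunE /default_image eS; do 2!case: ifP => // _; move=> [<-] [].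
Qed.

Lemma rank_initial_retract j : min_rank S <= j <= n -> rank (initial_retract j) = j.
Proof.
move=> /andP[ej jn]; rewrite -[RHS](card_ord_lt jn); apply: eq_card => i; rewrite [RHS]inE.
apply/pimageP/idP => [[i']|ij]; last by exists i; rewrite ffunE ij.
rewrite ffunE; case: ifP => [i'j [<-] //|_].
by rewrite /default_image; case: S ej => // j_gt0 [<-].
Qed.

(** By [principal_ideal_sub], the J-classes counted correspond to ranks from [rank (val x)] to [m],
    each attained by an [initial_retract]. *)
Lemma depthE x : m <= n -> depth x = m - rank (val x) + 1.
Proof.
move=> mn; have /andP[Sx xm] := valP x.
pose JJ (j : 'I_m.+1) := [set y : T | rank (val y) == j].
have JJ_attained (j : 'I_m.+1) : rank (val x) <= j -> exists y : T, rank (val y) = j.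
  move=> xj; have ej : min_rank S <= j <= n.
    by rewrite (leq_trans (min_rank_le n_gt0 Sx) xj) (leq_trans _ mn) // -ltnS.
  have rj := rank_initial_retract ej.
  have Ij : I (initial_retract j).
    by apply/andP; split; rewrite ?initial_retract_in_monoid // rj -ltnS.
  by exists (Sub _ Ij); rewrite /= rj.
rewrite /depth.
have -> : [set J_class y | y : T & principal_ideal x \subset principal_ideal y]
        = JJ @: ~: [set j : 'I_m.+1 | j < rank (val x)].
  apply/setP => C; apply/imsetP/imsetP => -[y].
    rewrite inE principal_ideal_sub => xy ->.
    have /andP[_ ym] := valP y.
    by exists (Ordinal (ym : rank (val y) < m.+1)); rewrite ?J_classE // !inE -leqNgt.
  rewrite !inE -leqNgt => xy ->; have [z zy] := JJ_attained y xy.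
  by exists z; rewrite ?inE ?principal_ideal_sub ?J_classE zy.
rewrite card_in_imset => [|j j']; last first.
  rewrite !inE -!leqNgt => /JJ_attained[y yj] _ /setP/(_ y).
  by rewrite !inE yj eqxx => /esym/eqP/val_inj.
have := cardsC [set j : 'I_m.+1 | j < rank (val x)].
rewrite card_ord_lt ?card_ord; last exact: leqW.
by move=> e; apply: (@addnI (rank (val x))); rewrite e addnA subnKC // addn1.
Qed.

End JClasses.

Section ShallowPresentation.
Variables (S : transf_monoid) (n m r : nat).
Local Open Scope group_scope.
Local Notation T := (rank_ideal S n m).
Local Notation R := (@shallow_rel S n m r).

Definition quot_value (q : cong_quot R) : T :=
  Sub (word_value (repr q)) (word_value_ideal (repr q)).

Lemma quot_value_class u : val (quot_value (cong_class R u)) = word_value u.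
Proof. exact/congruence_word_value/cong_classP/cong_classK. Qed.

Fact quot_valueM : {morph quot_value : p q / p * q}.
Proof.
move=> p q; apply: val_inj; rewrite -(cong_classK p) -(cong_classK q).
have -> : cong_class R (repr p) * cong_class R (repr q) = cong_class R (repr p * repr q).
  exact: cong_class_mul.
rewrite quot_value_class word_valueM.
have -> : val (quot_value (cong_class R (repr p)) * quot_value (cong_class R (repr q)))
  = val (quot_value (cong_class R (repr p))) * val (quot_value (cong_class R (repr q))) by [].
by rewrite !quot_value_class.
Qed.

HB.instance Definition _ := isMultiplicative.Build (cong_quot R) T quot_value quot_valueM.

Hypothesis shallow_bounds : forall k, min_rank S <= k < r ->
  [/\ k.+1 < m, k.+2 < n & (n + k < 2 * m)%N].
Hypothesis n_gt0 : 0 < n.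

Lemma quot_value_bij : bijective quot_value.
Proof.
have surj (x : T) : exists u : word (letter S n m r), word_value u = val x.
  have [u <-] := word_value_surj shallow_bounds n_gt0 (valP x); by exists u.
have /choice[g gE] := surj.
exists (fun x => cong_class R (g x)) => [q|x]; last first.
  by apply: val_inj; rewrite quot_value_class gE.
rewrite -[RHS]cong_classK; apply/cong_classP/(word_value_inj shallow_bounds n_gt0).
by rewrite gE.
Qed.

Definition shallow_presentation : presentation T := Presentation quot_value_bij.

Lemma represents_shallow u : val (@represents T shallow_presentation u) = word_value u.
Proof. exact: quot_value_class. Qed.

End ShallowPresentation.

(** * Relations of low rank are unavoidable *)

Section LowRankProduct.
Variables (S : transf_monoid) (n m' r : nat).
Hypothesis n_gt0 : 0 < n.
Local Open Scope group_scope.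

(* The last two lines say that neither of the kernels of [b] and [b'] contains the other;
   [None] plays the role of a point at which a partial map is undefined. *)
Lemma min_factorization_ex : min_rank S <= r < m' -> min_rank S < m' -> m' < n ->
    (2 * m' <= n + r)%N ->
  exists (b b' c : ptrans n) (o o1 o2 : option 'I_n), [/\ in_monoid S b, in_monoid S b', in_monoid S c,
    rank b = m' & rank b' <= m'] /\
   [/\ rank c = m', rank (b * c) = r, b' * c = b * c,
    obind b o1 = obind b o /\ obind b' o1 <> obind b' o &
    obind b' o2 = obind b' o /\ obind b o2 <> obind b o].
Proof.
move=> /andP[er rm] em mn mr.
pose d := default_image S n_gt0.
have m'1n : m'.-1 < n by apply: leq_ltn_trans mn; apply: leq_pred.
(* [i1] is the last point fixed by [b] and [i2] the first one collapsed; [b'] will be [b] preceded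
   by their transposition. Both are at least [r], so [b * c] does not separate them. *)
pose i1 := Ordinal m'1n; pose i2 := Ordinal mn.
have dE (i : 'I_n) : 0 < i -> Some i <> d.
  by rewrite /d /default_image; case: (S) => // + [i0]; rewrite i0.
have dfix (f : ptrans n) : (forall i : 'I_n, min_rank S = 1%N -> i = 0 :> nat -> f i = Some i) -> obind f d = d.
  by move: em er; rewrite /d /default_image; case: (S) => //= _ _; apply.
have m'_gt0 : 0 < m' by apply: leq_trans rm.
pose p : ptrans n := [ffun i => Some (tperm i1 i2 i)].
have Sp : in_monoid S p.
  apply: in_monoidI => eS i; last by rewrite ffunE.
  by move=> j q; rewrite !ffunE => -[<-] [/perm_inj].
have retractE j (i : 'I_n) :
    initial_retract S n_gt0 j i = if i < j then Some i else d by rewrite ffunE.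
pose b := initial_retract S n_gt0 m'.
have Sb : in_monoid S b by apply: initial_retract_in_monoid.
have rb : rank b = m' by apply: rank_initial_retract; rewrite (ltnW em) ltnW.
(* [c] fixes the points below [r] and shifts the block starting at [m'] down onto the points from
   [r] to [m'.-1]. This block fits because [2 * m' <= n + r], and [b] misses it. *)
pose sh i := [pick j : 'I_n | (r <= j < m') && (i + r == j + m')].
pose c : ptrans n := [ffun i : 'I_n => if i < r then Some i else
                         if sh i is Some j then Some j else d].
have shP (i : nat) j : sh i = Some j -> r <= j < m' /\ (i + r = j + m')%N.
  by rewrite /sh; case: pickP => // j' /andP[j'm /eqP ij'] [<-].
have Sc : in_monoid S c.
  apply: in_monoidI => eS i; last first.
    by rewrite ffunE /d /default_image eS; case: ifP => // _; case: (sh i).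
  move=> i' q; rewrite !ffunE /d /default_image eS.
  case: (ltnP i r) => ir; case: (ltnP i' r) => i'r.
  - by move=> [<-] [].
  - by case ei': (sh i') => [j|] // [<-] [ji]; have [] := shP _ _ ei'; rewrite ji leqNgt ir.
  - by case ei: (sh i) => [j|] // + [ji]; have [] := shP _ _ ei => + _ [jq]; rewrite jq -ji leqNgt i'r.
  case ei: (sh i) => [j|] //; case ei': (sh i') => [j'|] // [<-] [jj].
  have [_ e] := shP _ _ ei; have [_ e'] := shP _ _ ei'; apply: val_inj.
  by apply: (@addIn r); rewrite e e' jj.
have rc : rank c = m'.
  rewrite -[RHS](card_ord_lt (ltnW mn)); apply: eq_card => j; rewrite [RHS]inE.
  apply/pimageP/idP => [[i]|jm].
    rewrite ffunE; case: ltnP => ir; first by case=> <-; apply: ltn_trans rm.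
    case ei: (sh i) => [j'|]; first by case=> <-; have [/andP[]] := shP _ _ ei.
    by rewrite /d /default_image; case: (S) => // -[<-].
  have [jr|rj] := ltnP j r; first by exists j; rewrite ffunE jr.
  have ij : j - r + m' < n by clear -jm rj mr rm; lia.
  exists (Ordinal ij); rewrite ffunE /=.
  have -> : (j - r + m' < r) = false by clear -rm; lia.
  case ei: (sh _) => [j'|].
    by have [_ /= e] := shP _ _ ei; congr Some; apply: val_inj => /=; clear -e rj; lia.
  move: ei; rewrite /sh; case: pickP => // /(_ j) /negP[]; rewrite rj jm /=.
  by clear -rj; lia.
have bc : b * c = initial_retract S n_gt0 r.
  apply/ffunP => i; rewrite ptrans_mulE !retractE.
  have dc : obind c d = d.
    by apply: dfix => j e1 j0; rewrite ffunE j0; move: er; rewrite e1 => ->.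
  case: (ltnP i m') => im; last by rewrite dc ltnNge (leq_trans (ltnW rm) im).
  rewrite /= ffunE; case: ifP => // _; case ei: (sh i) => [j|] //.
  by have [/andP[rj _] e] := shP _ _ ei; clear -rj e im; lia.
have p1 : p i1 = Some i2 by rewrite ffunE tpermL.
have p2 : p i2 = Some i1 by rewrite ffunE tpermR.
have bd : obind b d = d.
  by apply: dfix => i e1 i0; rewrite retractE i0 m'_gt0.
have pbd : obind (p * b) d = d.
  apply: dfix => i e1 i0; rewrite ptrans_mulE ffunE tpermD /=.
  - by rewrite retractE i0 m'_gt0.
  - by apply/eqP => /(congr1 val) /=; rewrite i0; move: em; rewrite e1; clear; lia.
  by apply/eqP => /(congr1 val) /=; rewrite i0; clear -m'_gt0; lia.
have b1 : b i1 = Some i1 by rewrite retractE /= ltn_predL m'_gt0.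
have b2 : b i2 = d by rewrite retractE /= ltnn.
have di1 : Some i1 <> d.
  move=> i1d; have e1 : min_rank S = 1%N by move: i1d; rewrite /d /default_image; case: (S).
  by case: (dE i1) => //=; move: em; rewrite e1; clear; lia.
(* [b] identifies [i2] with the default [d] but not [i1]; for [p * b] the roles are exchanged. *)
exists b, (p * b), c, d, (Some i2), (Some i1); split; split=> //.
- exact: in_monoid_mul.
- by rewrite -rb rank_mulr.
- by rewrite bc rank_initial_retract // er (leq_trans (ltnW rm) (ltnW mn)).
- rewrite -mulgA bc; apply/ffunP => i; rewrite ptrans_mulE ffunE /=.
  have rm1 : (m'.-1 < r) = false by clear -rm; lia.
  have rm2 : (m' < r) = false by rewrite ltnNge ltnW.
  case: tpermP => [->|->|//]; by rewrite !retractE /= rm1 rm2.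
- by rewrite bd pbd /= ptrans_mulE p2 /= b1.
by rewrite bd pbd /= ptrans_mulE p1 /= b1 b2.
Qed.

End LowRankProduct.

(** One case of Levi's lemma for free monoids. *)
Lemma cat_eq_cat (A : Type) (s1 s2 t1 t2 : seq A) : s1 ++ s2 = t1 ++ t2 ->
    size s1 <= size t1 ->
  exists2 u, t1 = s1 ++ u & s2 = u ++ t2.
Proof.
elim: s1 t1 => [|a s1 IHs] [|b t1] //=; first by move=> ->; exists [::].
  by move=> ->; exists (b :: t1).
by move=> [-> /IHs e] /e[u -> ->]; exists u.
Qed.

(** * Following a cut in a word under the application of relations *)

Section Splits.
Variables (n m' r : nat) (A : Type) (phi : A -> ptrans n) (b c : ptrans n).
Hypotheses (rb : rank b = m') (rc : rank c = m') (rbc : rank (b * c)%g = r).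
Hypothesis high_rank : forall s : seq A, m' < rank (eval phi s) -> rank (eval phi s) = n.
Local Open Scope group_scope.
Local Notation ev := (eval phi).

(* When [m = n], a relation can move units across the cut; [g] keeps track of them. *)
Definition splits_as (s : seq A) : Prop := exists s1 s2 g h,
  [/\ s = s1 ++ s2, ev s1 = b * g, ev s2 = h * c & g * h = ptrans_id n].

(** Only a factor [u] straddling the cut matters. Its two parts have rank at least [m']; if one of
    them has larger rank it is a unit, and the cut can be moved to an end of [v]. *)
Lemma splits_as_step (p u v q : seq A) : ev u = ev v -> r < rank (ev u) ->
  splits_as (p ++ u ++ q) -> splits_as (p ++ v ++ q).
Proof.
move=> uv ru [s1 [s2 [g [h [e e1 e2 gh]]]]].
have [s1p|ps1] := leqP (size s1) (size p).
  have [p' pE s2E] := cat_eq_cat (esym e) s1p.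
  exists s1, (p' ++ v ++ q), g, h; split=> //; first by rewrite pE -catA.
  by rewrite -e2 s2E !eval_cat uv.
have [u1 s1E uqE] := cat_eq_cat e (ltnW ps1).
have [uu1|u1u] := leqP (size u) (size u1).
  have [q' u1E qE] := cat_eq_cat uqE uu1.
  exists (p ++ v ++ q'), s2, g, h; split=> //; first by rewrite qE !catA.
  by rewrite -e1 s1E u1E !eval_cat uv.
have [u2 uE s2E] := cat_eq_cat (esym uqE) (ltnW u1u).
have rbg : rank (b * g) = m'.
  apply/eqP; rewrite eqn_leq -{1}rb rank_mull /= -rb -{1}(ptrans_mulf1 b) -gh mulgA.
  exact: rank_mull.
have rhc : rank (h * c) = m'.
  apply/eqP; rewrite eqn_leq -{1}rc rank_mulr /= -rc -{1}(ptrans_mul1 c) -gh -mulgA.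
  exact: rank_mulr.
have pu1 : ev p * ev u1 = b * g by rewrite -eval_cat -s1E.
have u2q : ev u2 * ev q = h * c by rewrite -eval_cat -s2E.
have evv : ev v = ev u1 * ev u2 by rewrite -uv uE eval_cat.
have ru1 : m' <= rank (ev u1) by rewrite -rbg -pu1 rank_mulr.
have ru2 : m' <= rank (ev u2) by rewrite -rhc -u2q rank_mull.
move: ru1; rewrite leq_eqVlt => /orP[/eqP ru1|/high_rank/rank_full_inv[k u1k ku1]]; last first.
  exists p, (v ++ q), (g * k), (ev u1 * h); split=> //.
  - by rewrite mulgA -pu1 -mulgA u1k ptrans_mulf1.
  - by rewrite eval_cat evv -!mulgA u2q.
  by rewrite -mulgA (mulgA k) ku1 ptrans_mul1.
move: ru2; rewrite leq_eqVlt => /orP[/eqP ru2|/high_rank/rank_full_inv[k u2k ku2]]; last first.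
  exists (p ++ v), q, (g * ev u2), (k * h); split=> //; first by rewrite catA.
  - by rewrite eval_cat evv mulgA pu1 mulgA.
  - by rewrite -mulgA -u2q mulgA ku2 ptrans_mul1.
  by rewrite -mulgA (mulgA (ev u2)) u2k ptrans_mul1.
(* Both parts have rank [m'], so [ev u1] has the image of [b * g] and [ev u2] the kernel of [h * c].
   Their product then has rank at most that of [b * c], contrary to [r < rank (ev u)]. *)
have le1 : rank (ev u1 * ev u2) <= rank (b * g * ev u2).
  by rewrite -pu1; apply: leq_rank_mul; rewrite pu1 rbg.
have eq2 : rank (b * g * ev u2 * ev q) = rank (b * g * ev u2).
  by apply: rank_mul_mid; rewrite u2q rhc.
have bgq : b * g * ev u2 * ev q = b * c.
  by rewrite -mulgA u2q mulgA -(mulgA b) gh ptrans_mulf1.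
by move: ru; rewrite uv evv ltnNge -rbc -bgq eq2 le1.
Qed.

End Splits.

Section DeepRelation.
Variables (S : transf_monoid) (n m m' r : nat).
Hypothesis n_gt0 : 0 < n.
Local Open Scope group_scope.
Local Notation T := (rank_ideal S n m).

Lemma representsM (P : presentation T) u v :
  @represents T P (u * v) = represents u * represents v.
Proof.
rewrite /represents -gmulfM; congr (pres_iso P _).
exact/esym/cong_class_mul.
Qed.

Definition letter_value (P : presentation T) (a : alphabet P) : ptrans n :=
  val (@represents T P (Sub [:: a] isT)).

Lemma eval_letter_value (P : presentation T) (u : word (alphabet P)) :
  eval (@letter_value P) (val u) = val (represents u).
Proof.
case: u => s s0 /=; elim: s s0 => // a [|a' s] IHs s0.
  by rewrite /= ptrans_mulf1 /letter_value; congr (val (represents _)); apply: val_inj.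
have -> : exist _ (a :: a' :: s) s0 = (Sub [:: a] isT : word (alphabet P)) * (Sub (a' :: s) isT).
  exact: val_inj.
rewrite representsM; exact: (congr1 (fun f => @letter_value P a * f) (IHs isT)).
Qed.

(** Otherwise [splits_as] passes from a word for [b * c] to one for [b' * c]. The new cut lies
    beyond or within the word for [b'], giving [b' * t = b * g] or [b' = b * g * t]; each violates
    one of the two kernel conditions. *)
Lemma exists_deep_relation (P : presentation T) :
    (min_rank S <= r < m') -> min_rank S < m' -> m' < n -> m' <= m -> m <= n ->
    (2 * m' <= n + r)%N -> (m < n -> m' = m) -> (m = n -> m' = n.-1) ->
  ~ forall u v, @relations T P u v -> r < rank (val (represents u)).
Proof.
move=> er em mn m'm mn' mr m_lt m_eq high.
have [b [b' [c [o [o1 [o2 [[Sb Sb' Sc rb rb'] [rc rbc bc [bo bo'] [b'o b'o']]]]]]]]] :=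
  min_factorization_ex n_gt0 er em mn mr.
have surj f : rank_ideal_pred S m f -> exists w : word (alphabet P), val (represents w) = f.
  move=> If; have [g _ gK] := pres_iso_bij P.
  exists (repr (g (Sub f If))); rewrite /represents cong_classK gK //.
have [|wb wbE] := surj b; first by apply/andP; rewrite rb.
have [|wb' wb'E] := surj b'; first by apply/andP; rewrite (leq_trans rb').
have [|wc wcE] := surj c; first by apply/andP; rewrite rc.
pose ev := eval (@letter_value P).
(* For [m < n] no nonempty word has rank above [m' = m]; for [m = n], only rank [n] lies above
   [m' = n.-1]. *)
have high_rank s : m' < rank (ev s) -> rank (ev s) = n.
  have [->|s0] := eqVneq s [::]; first by rewrite rank_ptrans_id.
  have /andP[_ rs] : rank_ideal_pred S m (ev s).
    by apply: eval_ideal; [move=> a; apply: valP | apply/eqP].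
  move=> m's; apply/eqP; rewrite eqn_leq rank_leq /=.
  move: mn'; rewrite leq_eqVlt => /orP[/eqP/[dup] mn' /m_eq m'n|/m_lt m'E].
    by rewrite -[leqLHS](prednK n_gt0) -m'n.
  by move: m's; rewrite m'E ltnNge rs.
have relE u v : @relations T P u v -> represents u = represents v.
  by move=> uv; rewrite /represents; congr (pres_iso P _); apply/cong_classP/cong_rel.
(* The arbitrary context [p], [q] makes the induction pass through products. *)
have inv u v : congruence (@relations T P) u v -> forall p q,
    splits_as (@letter_value P) b c (p ++ val u ++ q) <->
    splits_as (@letter_value P) b c (p ++ val v ++ q).
  elim=> {u v} [u v uv p q|u p q|u v _ uv p q|u v w _ uv _ vw p q|u u' v v' _ uu' _ vv' p q].
  - have e : ev (val u) = ev (val v) by rewrite /ev !eval_letter_value (relE _ _ uv).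
    have ru : r < rank (ev (val u)) by rewrite /ev eval_letter_value (high _ _ uv).
    split; apply: (splits_as_step rb rc rbc high_rank) => //.
    by rewrite -/ev -e.
  - by [].
  - exact: iff_sym.
  - exact: iff_trans (uv p q) (vw p q).
  rewrite -!catA; apply: iff_trans (uu' p (val v ++ q)) _.
  by have := vv' (p ++ val u') q; rewrite -!catA.
have cong_bc : congruence (@relations T P) (wb * wc) (wb' * wc).
  apply/cong_classP/(bij_inj (pres_iso_bij P)).
  rewrite -!/(represents _) !representsM; apply: val_inj => /=.
  by rewrite wbE wb'E wcE bc.
have evE w : ev (val w) = val (represents w) by apply: eval_letter_value.
have [] := (inv _ _ cong_bc [::] [::]).1.
  exists (val wb), (val wc), (ptrans_id n), (ptrans_id n).
  by split; rewrite ?cats0 -/ev ?evE ?wbE ?wcE ?ptrans_mul1 ?ptrans_mulf1.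
rewrite cats0 => s1 [s2 [g [h [e e1 _ gh]]]].
have {}e : val wb' ++ val wc = s1 ++ s2 := e.
have ginj x y : obind g x = obind g y -> x = y.
  have gK z : obind h (obind g z) = z.
    by case: z => [z|] //=; rewrite -ptrans_mulE gh ffunE.
  by move=> /(congr1 (obind h)); rewrite !gK.
have obM (f1 f2 : ptrans n) x : obind (f1 * f2) x = obind f2 (obind f1 x).
  by case: x => //= x; rewrite ptrans_mulE.
have [le|/ltnW le] := leqP (size (val wb')) (size s1).
  have [t s1E _] := cat_eq_cat e le.
  have b'b : b' * ev t = b * g by rewrite -e1 s1E eval_cat -/ev evE wb'E.
  by apply: b'o'; apply: ginj; rewrite -!obM -b'b !obM b'o.
have [t wb'tE _] := cat_eq_cat (esym e) le.
have b'b : b' = b * g * ev t by rewrite -e1 -eval_cat -wb'tE -/ev evE wb'E.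
by apply: bo'; rewrite b'b !obM bo.
Qed.

End DeepRelation.

(** * The two bounds combined *)

Theorem mainTheorem1 (n : nat) (S : transf_monoid) (m : nat) :
  3 <= n ->
  min_rank S <= m <= n ->
  relational_depth_is (rank_ideal S n m)
    (if m < n then m - maxn (min_rank S) (2 * m - n) + 1 else 3).
Proof.
move=> n3 /andP[em mn]; have n0 : 0 < n by apply: leq_trans n3.
have e1 : min_rank S <= 1 by case: S {em}.
pose m' := minn m n.-1; pose r := maxn (min_rank S) (2 * m' - n).
have rm : r <= m by rewrite /r /m'; lia.
(* For [m = n] one has [r = n - 2], as [n >= 3]; this yields the value 3. *)
have -> : (if m < n then m - maxn (min_rank S) (2 * m - n) + 1 else 3) = m - r + 1.
  by rewrite /r /m'; case: ltnP => mn'; lia.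
have dE x := @depthE S n m n0 x mn.
split.
  have bounds k : min_rank S <= k < r -> [/\ k.+1 < m, k.+2 < n & n + k < 2 * m].
    by rewrite /r /m' => kr; split; lia.
  exists (shallow_presentation bounds n0); split.
    have rr : min_rank S <= r <= n by rewrite leq_maxl (leq_trans rm).
    have rk := rank_initial_retract n0 rr.
    have L : rank_ideal_pred S m (initial_retract S n0 r) && (r <= rank (initial_retract S n0 r)).
      by rewrite rk leqnn andbT; apply/andP; split; [apply: initial_retract_in_monoid | rewrite rk].
    have [u uE] := letter_word L.
    (* The trivial relation [u = u] of rank [r] belongs to the presentation and attains the
       bound. *)
    exists u, u; split; first by split; rewrite ?uE ?rk.
    by rewrite dE represents_shallow uE rk.
  move=> u v [_ ru]; rewrite dE represents_shallow leq_add2r.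
  exact: leq_sub2l.
move=> P e [[u [v [uv <-]]] max_e].
(* In this case the claimed depth is 1, a lower bound for every depth. *)
have [mE|em'] := eqVneq m (min_rank S).
  have mr : m - r = 0 by rewrite /r; clear -mE; lia.
  by rewrite dE leq_add2r mr.
rewrite leqNgt; apply/negP => lt.
apply: (@exists_deep_relation S n m m' r n0 P); rewrite /r /m'; try lia.
(* A depth below [m - r + 1] means a rank above [r]. *)
move=> u' v' /max_e le; have := leq_ltn_trans le lt.
rewrite dE ltn_add2r => h; rewrite ltnNge; apply/negP => /(leq_sub2l m).
by rewrite leqNgt h.
Qed.
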